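(* Let $H\colon\mathbb R^n\times\mathbb R^n\to\mathbb R$, $(z,z_x)\mapsto H(z,z_x)$, be smooth, let $\mathcal H=\int H(z,z_x)\,\mathrm dx$, and let $K$ be a (constant, real, possibly singular) $n\times n$ antisymmetric matrix. Let $\overline\nabla$ be a discrete gradient. Consider, for $z(x,t)\in\mathbb R^n$, the PDE $$Kz_t=\frac{\delta\mathcal H}{\delta z}=H_z-\partial_xH_{z_x}\qquad(\mathrm P)$$ and the discrete gradient method with time step $\Delta t\ne0$ $$K\frac{z_1-z_0}{\Delta t}=\overline{H_z}-\partial_x\overline{H_{z_x}}.\qquad(\mathrm D)$$ Then (P) has an energy conservation law with conserved density $H$ and flux given by a bilinear form in $z_t$ and the derivatives of $H$, and (D) has a discrete energy conservation law with conserved density $H$ and flux given by the same bilinear form with $z_t$ replaced by $(z_1-z_0)/\Delta t$ and the derivatives of $H$ replaced by discrete gradients. That is, there is a bilinear differential form $B$ such that: (i) every smooth solution $z(x,t)$ of (P) satisfies $$\partial_t\big(H(z,z_x)\big)+\partial_x\big(B(z_t,h)\big)=0,\qquad h=(H_z,H_{z_x}),$$ with $H_z,H_{z_x}$ evaluated at $(z,z_x)$; (ii) every pair of smooth functions $z_0,z_1$ of $x$ satisfying (D) satisfies $$\frac{H(z_1,z_{1x})-H(z_0,z_{0x})}{\Delta t}+\partial_x\left(B\left(\frac{z_1-z_0}{\Delta t},\overline h\right)\right)=0,\qquad\overline h=(\overline{H_z},\overline{H_{z_x}}).$$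
   Context: Discrete gradient: on a vector space $V$ with inner product $a^\top b$, a discrete gradient assigns to each smooth $H\colon V\to\mathbb R$ a map $\overline\nabla H\colon V\times V\to V$ with $$(v_1-v_0)^\top\overline\nabla H(v_0,v_1)=H(v_1)-H(v_0)\quad\text{for all }v_0,v_1\in V$$ (the discrete gradient axiom). (For consistency one usually also requires $\overline\nabla H(v,v)=\nabla H(v)$, but this is not needed for conservation properties.) We assume $\overline\nabla H$ is smooth enough that all $x$-derivatives written exist. Here $V=\mathbb R^n\times\mathbb R^n$ with variables $(z,z_x)$. $H_z,H_{z_x}\in\mathbb R^n$ denote the partial gradients of $H$ with respect to its first and second arguments, and $\overline{H_z},\overline{H_{z_x}}\in\mathbb R^n$ denote the corresponding components of $\overline\nabla H$. For functions $z_0,z_1$ of $x$ these components are evaluated pointwise in $x$ at $v_0=(z_0(x),z_{0x}(x))$, $v_1=(z_1(x),z_{1x}(x))$, so that at each $x$ $$(z_1-z_0)^\top\overline{H_z}+(z_{1x}-z_{0x})^\top\overline{H_{z_x}}=H(z_1,z_{1x})-H(z_0,z_{0x}).$$ A subscript $x$ or $\partial_x$ denotes the total $x$-derivative. Solutions are smooth functions on an open interval in $x$ (times an open interval in $t$, in the continuous case); no boundary conditions are imposed, and all statements are local in $x$. Bilinear differential form: an expression $B(g,h)=\sum_{j,k\ge0}(\partial_x^jg)^\top C_{jk}\,\partial_x^kh$ (finite sum), for smooth functions $g$ of $x$ with values in $\mathbb R^n$ and $h$ of $x$ with values in $\mathbb R^n\times\mathbb R^n$, with constant matrices $C_{jk}$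 (in particular, independent of $z$). *)

(* Defs.v *)
From mathcomp Require Export all_boot all_order all_algebra.
From mathcomp Require Export all_classical all_reals all_analysis.
Export numFieldNormedType.Exports.
Export Order.TTheory GRing.Theory Num.Theory.

Set Implicit Arguments.
Unset Strict Implicit.
Unset Printing Implicit Defensive.

Local Open Scope ring_scope.
Local Open Scope classical_set_scope.

(* Derivatives are total functions in the library; smoothness is what makes
   them meaningful: all iterated directional derivatives are (Frechet)
   differentiable at every point of U.  For open U in a finite-dimensional
   space this is C^infty on U. *)
Definition iter_derive (R : realType) (V W : normedModType R)
    (vs : seq V) (f : V -> W) : V -> W :=
  foldr (fun v (g : V -> W) => 'D_v g) f vs.

Definition smooth_on (R : realType) (V W : normedModType R)
    (U : set V) (f : V -> W) : Prop :=
  forall (vs : seq V) (x : V), U x -> differentiable (iter_derive vs f) x.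

Definition smooth (R : realType) (V W : normedModType R) (f : V -> W) : Prop :=
  smooth_on setT f.

(* Bounded or unbounded. *)
Definition open_interval (R : realType) (I : set R) : Prop :=
  open I /\ is_interval I.

(* The phase space R^n x R^n of the variables (z, z_x). *)
Notation phase R n := ('cV[R]_n * 'cV[R]_n)%type.

Definition inner (R : realType) (n : nat) (a b : phase R n) : R :=
  (a.1^T *m b.1) 0 0 + (a.2^T *m b.2) 0 0.

(* (H_z, H_{z_x}): the gradient of H with respect to inner, not to the sup norm
   that matrices carry as a normed module. *)
Definition grad (R : realType) (n : nat) (H : phase R n -> R) (v : phase R n) :
    phase R n :=
  (\col_(i < n) 'D_(delta_mx i 0, 0) H v,
   \col_(i < n) 'D_(0, delta_mx i 0) H v).

Definition discrete_gradient (R : realType) (n : nat)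
    (dg : (phase R n -> R) -> phase R n -> phase R n -> phase R n) : Prop :=
  forall H : phase R n -> R, smooth H ->
  forall v0 v1 : phase R n, inner (v1 - v0) (dg H v0 v1) = H v1 - H v0.

(* x |-> (z, z_x) *)
Definition prolong (R : realType) (n : nat) (w : R -> 'cV[R]_n) (x : R) :
    phase R n :=
  (w x, derive1 w x).

Definition grad_along (R : realType) (n : nat) (H : phase R n -> R)
    (w : R -> 'cV[R]_n) (x : R) : phase R n :=
  grad H (prolong w x).

Definition dgrad_along (R : realType) (n : nat)
    (dH : phase R n -> phase R n -> phase R n)
    (w0 w1 : R -> 'cV[R]_n) (x : R) : phase R n :=
  dH (prolong w0 x) (prolong w1 x).

(* For a pair h = (h_1, h_2) of R^n-valued functions: h_1 - d_x h_2. *)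
Definition euler (R : realType) (n : nat) (h : R -> phase R n) (x : R) :
    'cV[R]_n :=
  (h x).1 - derive1 (fun y => (h y).2) x.

(* The variational derivative of the functional \int H(z, z_x) dx. *)
Definition variational_derivative (R : realType) (n : nat)
    (H : phase R n -> R) (w : R -> 'cV[R]_n) : R -> 'cV[R]_n :=
  euler (grad_along H w).

Definition pde_solution (R : realType) (n : nat) (H : phase R n -> R)
    (K : 'M[R]_n) (I J : set R) (z : R -> R -> 'cV[R]_n) : Prop :=
  forall x t, I x -> J t ->
    K *m derive1 (z x) t = variational_derivative H (z ^~ t) x.

Definition increment (R : realType) (n : nat) (dt : R)
    (z0 z1 : R -> 'cV[R]_n) (x : R) : 'cV[R]_n :=
  dt^-1 *: (z1 x - z0 x).

(* A discrete gradient need not be differentiable, so satisfying the equation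
   includes the existence of the x-derivative occurring in it. *)
Definition dgm_solution (R : realType) (n : nat)
    (dH : phase R n -> phase R n -> phase R n) (K : 'M[R]_n) (dt : R)
    (I : set R) (z0 z1 : R -> 'cV[R]_n) : Prop :=
  forall x, I x ->
    derivable (fun y => (dgrad_along dH z0 z1 y).2) x 1 /\
    K *m increment dt z0 z1 x = euler (dgrad_along dH z0 z1) x.

(* The derivatives of g occur up to order bdf_l - 1, those of h up to order
   bdf_r - 1. *)
Record bdform (R : realType) (n : nat) := BDForm {
  bdf_l : nat;
  bdf_r : nat;
  bdf_coef : 'I_bdf_l -> 'I_bdf_r -> 'M[R]_(n, n + n) }.

Definition bdf_eval (R : realType) (n : nat) (B : bdform R n)
    (g : R -> 'cV[R]_n) (h : R -> phase R n) (x : R) : R :=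
  \sum_(j < bdf_l B) \sum_(k < bdf_r B)
    ((derive1n j g x)^T *m bdf_coef j k *m
       col_mx (derive1n k h x).1 (derive1n k h x).2) 0 0.

(* The derivatives f^(1), ..., f^(m) exist on I. *)
Definition times_derivable (R : realType) (W : normedModType R) (m : nat)
    (I : set R) (f : R -> W) : Prop :=
  forall k x, (k < m)%N -> I x -> derivable (derive1n k f) x 1.

(* Main.v *)
Require Import Defs.

Set Implicit Arguments.
Unset Strict Implicit.
Unset Printing Implicit Defensive.

Local Open Scope ring_scope.
Local Open Scope classical_set_scope.

(** The bilinear form is B(g, h) = - g^T h_2.  Write g for z_t, respectively
    for the increment (z_1 - z_0) / dt, and h for the gradient, respectively the
    discrete gradient, along the solution.  Both equations then read
    K g = h_1 - d_x h_2.  Pairing with g annihilates the left-hand side, since K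
    is antisymmetric, so g^T h_1 = g^T d_x h_2, and hence
    d_x B(g, h) = - g_x^T h_2 - g^T d_x h_2 = - (g^T h_1 + g_x^T h_2)
                = - <(g, g_x), h>.
    This computation ([is_derive_flux]) does not distinguish the two cases.

    It remains to recognise <(g, g_x), h> as the rate of change of the energy.
    For the discrete method this is the discrete gradient axiom divided by dt.
    For the PDE, the chain rule and the description of the differential of H by
    its gradient ([diff_grad]) give d_t H(z, z_x) = <(z_t, d_t z_x), h>, whereas
    g_x is d_x z_t: the two agree by the symmetry of mixed partial derivatives
    ([smooth_derive_comm]).  The symmetry is obtained by writing the second
    difference of f over a small parallelogram, through the mean value theorem,
    as a value of either mixed derivative ([second_difference]). *)

(** * Symmetry of mixed derivatives *)

(** Restricting to a line turns directional derivatives into derivatives in one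
    variable, to which the mean value theorem applies. *)
Lemma is_derive_along (R : realType) (V W : normedModType R) (f : V -> W)
    (p v : V) (s : R) (d : W) :
  is_derive (p + s *: v) v f d -> is_derive s 1 (fun r => f (p + r *: v)) d.
Proof.
have E : (fun h : R => h^-1 *: (((fun r => f (p + r *: v)) \o shift s)
                               (h *: (1 : R)) - f (p + s *: v)))
       = (fun h : R => h^-1 *: ((f \o shift (p + s *: v)) (h *: v)
                               - f (p + s *: v))).
  apply/funext => h /=; congr (_ *: (f _ - _)).
  by rewrite [h *: 1]mulr1 scalerDl addrCA.
by move=> [df Df]; split; rewrite /derivable /derive E.
Qed.

Lemma mvt_from0 (R : realType) (f df : R -> R) (h : R) :
  0 < h -> (forall a, 0 <= a <= h -> is_derive a 1 f (df a)) ->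
  exists2 c, 0 <= c <= h & f h - f 0 = df c * h.
Proof.
move=> h0 Df; have [|| c] := @MVT_segment R f df 0 h (ltW h0).
- by move=> a; rewrite in_itv/= => /andP[/ltW a0 /ltW ah]; apply: Df;
  rewrite a0.
- apply: derivable_within_continuous => a; rewrite in_itv/= => ah.
  exact: (@ex_derive _ _ _ _ _ _ _ (Df a ah)).
- by rewrite in_itv/= subr0 => ch E; exists c.
Qed.

(** The mean value theorem is used twice: first in the direction u, for the
    difference of f between two parallel sides, then in the direction v, for
    the derivative along u.  As the second difference is symmetric in u and v
    and the right-hand side is not, exchanging u and v links the two mixed
    derivatives. *)
Lemma second_difference (R : realType) (V : normedModType R) (f : V -> R)
    (p u v : V) (h : R) :
  0 < h ->
  (forall a b, 0 <= a <= h -> 0 <= b <= h ->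
     derivable f (p + a *: u + b *: v) u /\
     derivable ('D_u f) (p + a *: u + b *: v) v) ->
  exists a b : R, [/\ 0 <= a <= h, 0 <= b <= h &
    f (p + h *: u + h *: v) - f (p + h *: u) - f (p + h *: v) + f p
    = 'D_v ('D_u f) (p + a *: u + b *: v) * (h * h)].
Proof.
move=> h0 df.
have hh : 0 <= h <= h by rewrite lexx ltW.
have z0h : 0 <= (0 : R) <= h by rewrite lexx ltW.
pose phi b := fun a => f (p + b *: v + a *: u).
have dphi b a : 0 <= b <= h -> 0 <= a <= h ->
    is_derive a 1 (phi b) ('D_u f (p + a *: u + b *: v)).
  move=> bh ah; apply: is_derive_along; rewrite addrAC.
  exact: (derivableP (df a b ah bh).1).
have dpsi a : 0 <= a <= h -> is_derive a 1 (phi h - phi 0)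
    ('D_u f (p + a *: u + h *: v) - 'D_u f (p + a *: u + 0 *: v)).
  by move=> ah; apply: is_deriveB; apply: dphi.
have [a ah E1] := mvt_from0 h0 dpsi.
have dchi b : 0 <= b <= h ->
    is_derive b 1 (fun b => 'D_u f (p + a *: u + b *: v))
      ('D_v ('D_u f) (p + a *: u + b *: v)).
  by move=> bh; exact: is_derive_along (derivableP (df a b ah bh).2).
have [b bh E2] := mvt_from0 h0 dchi.
exists a, b; split => //.
rewrite mulrA -E2 -E1.
rewrite /phi !fctE !scale0r !addr0 [p + _ *: v + _]addrAC.
by rewrite opprB addrA [RHS]addrAC.
Qed.

(** By [second_difference] the two mixed derivatives take a common value at
    two points as close to p as desired, and both are continuous at p. *)
Lemma derive_comm (R : realType) (V : normedModType R) (f : V -> R)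
    (p u v : V) :
  (\forall q \near p, derivable f q u /\ derivable ('D_u f) q v) ->
  (\forall q \near p, derivable f q v /\ derivable ('D_v f) q u) ->
  {for p, continuous ('D_v ('D_u f))} -> {for p, continuous ('D_u ('D_v f))} ->
  'D_v ('D_u f) p = 'D_u ('D_v f) p.
Proof.
move=> nu nv cu cv; apply/eqP; rewrite -subr_eq0 -normr_le0.
apply/ler_addgt0Pl => e e0; rewrite addr0.
have e20 : 0 < e / 2 by rewrite divr_gt0.
have ncu : \forall q \near p,
    `|'D_v ('D_u f) p - 'D_v ('D_u f) q| <= e / 2.
  by move/cvgrPdist_le : cu; apply.
have ncv : \forall q \near p,
    `|'D_u ('D_v f) p - 'D_u ('D_v f) q| <= e / 2.
  by move/cvgrPdist_le : cv; apply.
(* With the step h below, the closed parallelogram spanned at p by h u and h v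
   lies in the ball of radius r; adding 1 keeps the denominator nonzero when u
   and v vanish. *)
have [r /= r0 rP] :=
  (nbhs_ballP _ _).1 (filterI (filterI nu nv) (filterI ncu ncv)).
pose h := r / (`|u| + `|v| + 1).
have s0 : 0 < `|u| + `|v| + 1 by rewrite ltr_wpDl// addr_ge0.
have h0 : 0 < h by rewrite divr_gt0.
have inb a b : 0 <= a <= h -> 0 <= b <= h -> ball p r (p + a *: u + b *: v).
  move=> /andP[a0 ah] /andP[b0 bh]; rewrite -ball_normE /= -addrA opprD addNKr.
  rewrite normrN (le_lt_trans (ler_normD _ _))// !normrZ !ger0_norm//.
  rewrite (@le_lt_trans _ _ (h * (`|u| + `|v|)))//.
    by rewrite mulrDr lerD// ler_wpM2r.
  by rewrite -[ltRHS](divfK (lt0r_neq0 s0)) ltr_pM2l// ltrDl.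
have [|a [b [ah bh E]]] := @second_difference _ _ f p u v h h0.
  by move=> a b ah bh; case: (rP _ (inb _ _ ah bh)) => -[].
have [|b' [a' [bh' ah' E']]] := @second_difference _ _ f p v u h h0.
  by move=> b' a' bh' ah'; rewrite addrAC; case: (rP _ (inb _ _ ah' bh')) => -[].
have hh0 : h * h != 0 by rewrite mulf_neq0// lt0r_neq0.
have EE : 'D_v ('D_u f) (p + a *: u + b *: v)
        = 'D_u ('D_v f) (p + b' *: v + a' *: u).
  rewrite [p + h *: v + h *: u]addrAC in E'; apply: (mulIf hh0).
  by rewrite -[LHS]E -[RHS]E'; congr (_ + _); rewrite [LHS]addrAC.
have [_ [/= Pu _]] := rP _ (inb _ _ ah bh).
have [_ [_ /=]] := rP _ (inb _ _ ah' bh').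
rewrite addrAC => Pv.
rewrite (splitr e) (le_trans _ (lerD Pu Pv))// EE.
by rewrite [X in _ <= _ + X]distrC (le_trans _ (ler_normD _ _))// addrA subrK.
Qed.

(** The mean value theorem being restricted to real values, [derive_comm] is
    applied entrywise; entries and directional derivatives may be exchanged only
    where the latter exist, that is on the open set U. *)
Lemma smooth_derive_comm (R : realType) (V : normedModType R) (m n : nat)
    (U : set V) (f : V -> 'M[R]_(m, n)) (u v p : V) :
  open U -> smooth_on U f -> U p ->
  'D_v ('D_u f) p = 'D_u ('D_v f) p.
Proof.
move=> oU sf Up; have nU : \forall q \near p, U q by exact: open_nbhs_nbhs.
have D1 w q i j : U q -> 'D_w f q i j = 'D_w (fun r => f r i j) q.
  move=> Uq; rewrite derive_mx ?mxE//.
  exact/diff_derivable/(sf [::]).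
have D2 w w' i j : \forall q \near p, 'D_w' ('D_w f) q i j
                   = 'D_w' ('D_w (fun r => f r i j)) q.
  near=> q; have nq : \forall q' \near q, U q'.
    by apply: open_nbhs_nbhs; split=> //; near: q.
  rewrite derive_mx ?mxE; last first.
    by apply/diff_derivable/(sf [:: w]); near: q.
  by apply: near_eq_derive; apply: filterS nq => q'; exact: D1.
have nd w w' i j : \forall q \near p, derivable (fun r => f r i j) q w /\
      derivable ('D_w (fun r => f r i j)) q w'.
  near=> q; split.
    apply: (derivable_mxP f q w).1; apply: diff_derivable.
    by apply: (sf [::]); near: q.
  have nq : \forall q' \near q, U q'.
    by apply: open_nbhs_nbhs; split=> //; near: q.
  have := (derivable_mxP ('D_w f) q w').1.
  move=> /(_ _ i j) df; apply: near_eq_derivable (df _); last first.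
    by apply/diff_derivable/(sf [:: w]); near: q.
  by apply: filterS nq => q'; exact: D1.
have cd w w' i j : {for p, continuous ('D_w' ('D_w (fun r => f r i j)))}.
  have c : {for p, continuous ('D_w' ('D_w f))}.
    exact/differentiable_continuous/(sf [:: w'; w]).
  have := continuous_comp c (@coord_continuous _ m n i j _).
  rewrite /prop_for /continuous_at /= (nbhs_singleton (D2 w w' i j)).
  exact: cvg_trans (near_eq_cvg (D2 w w' i j)).
apply/matrixP => i j.
rewrite [LHS](nbhs_singleton (D2 u v i j)) [RHS](nbhs_singleton (D2 v u i j)).
exact: derive_comm.
Unshelve. all: by end_near. Qed.

(** * Dot products and gradients *)

Definition dot (R : realType) (n : nat) (a b : 'cV[R]_n) : R :=
  (a^T *m b) 0 0.

Lemma dotE (R : realType) (n : nat) (a b : 'cV[R]_n) :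
  dot a b = \sum_i a i 0 * b i 0.
Proof. by rewrite /dot mxE; apply: eq_bigr => i _; rewrite mxE. Qed.

Lemma is_derive_dot (R : realType) (V : normedModType R) (n : nat)
    (g h : V -> 'cV[R]_n) (x v : V) (dg dh : 'cV[R]_n) :
  is_derive x v g dg -> is_derive x v h dh ->
  is_derive x v (fun y => dot (g y) (h y)) (dot dg (h x) + dot (g x) dh).
Proof.
have coord (k : V -> 'cV[R]_n) dk i : is_derive x v k dk ->
    is_derive x v (fun y => k y i 0) (dk i 0).
  move=> [dek <-]; rewrite derive_mx// mxE; apply: derivableP.
  exact: (derivable_mxP k x v).1.
move=> Dg Dh.
have -> : (fun y => dot (g y) (h y))
        = \sum_i ((fun y => g y i 0) * (fun y => h y i 0)).
  by apply/funext => y; rewrite dotE fct_sumE.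
have D i := is_deriveM (coord _ _ i Dg) (coord _ _ i Dh).
apply: is_derive_eq (is_derive_sum D) _.
rewrite !dotE -big_split/=; apply: eq_bigr => i _.
by rewrite addrC; congr (_ + _); rewrite [LHS]mulrC.
Qed.

Lemma dot_antisym (R : realType) (n : nat) (K : 'M[R]_n) (g : 'cV[R]_n) :
  K^T = - K -> dot g (K *m g) = 0.
Proof.
move=> KT; have : dot g (K *m g) = - dot g (K *m g).
  rewrite /dot -[in LHS](trmxK (g^T *m _)) [LHS]mxE !trmx_mul trmxK KT.
  by rewrite mulmxN mulNmx mulmxA mxE.
by move/eqP; rewrite eq_sym eqNr => /eqP.
Qed.

(** The differential is linear, and the gradient lists its values on the
    canonical basis of the phase space. *)
Lemma diff_grad (R : realType) (n : nat) (H : phase R n -> R)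
    (v w : phase R n) :
  differentiable H v -> 'd H v w = inner w (grad H v).
Proof.
move=> dH.
have E (c : 'cV[R]_n) : c = \sum_i c i 0 *: delta_mx i 0.
  by rewrite {1}[c]matrix_sum_delta; apply: eq_bigr => i _; rewrite big_ord1.
have Ew : w = \sum_i (w.1 i 0 *: (delta_mx i 0, 0)
                     + w.2 i 0 *: (0, delta_mx i 0)).
  rewrite [LHS]surjective_pairing [RHS]surjective_pairing.
  rewrite (raddf_sum fst) (raddf_sum snd)/=.
  by rewrite [w.1 in LHS]E [w.2 in LHS]E; congr (_, _); apply: eq_bigr => i _;
    rewrite scaler0 ?addr0 ?add0r.
rewrite [in LHS]Ew linear_sum /inner -/(dot _ _) -/(dot _ (grad H v).2) !dotE.
rewrite -big_split/=; apply: eq_bigr => i _.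
by rewrite linearD !linearZ/= !mxE !deriveE.
Qed.

(** * The flux *)

Definition flux_form (R : realType) (n : nat) : bdform R n :=
  @BDForm R n 1 1 (fun _ _ => row_mx 0 (- 1%:M)).

Lemma flux_formE (R : realType) (n : nat) (g : R -> 'cV[R]_n)
    (h : R -> phase R n) :
  bdf_eval (flux_form R n) g h = - (fun x => dot (g x) (h x).2).
Proof.
apply/funext => x; rewrite /bdf_eval !big_ord1/= -mulmxA mul_row_col.
by rewrite mul0mx add0r mulNmx mul1mx mulmxN mxE.
Qed.

(** The core of both conservation laws.  The product rule gives
    - (dg^T h_2 + g^T d_x h_2), and antisymmetry of K turns the last term into
    g^T h_1, so that the derivative of h_2 disappears from the result. *)
Lemma is_derive_flux (R : realType) (n : nat) (K : 'M[R]_n)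
    (g : R -> 'cV[R]_n) (h : R -> phase R n) (x : R) (dg : 'cV[R]_n) :
  K^T = - K -> is_derive x 1 g dg -> derivable (fun y => (h y).2) x 1 ->
  K *m g x = euler h x ->
  is_derive x 1 (bdf_eval (flux_form R n) g h) (- inner (g x, dg) (h x)).
Proof.
move=> KT Dg /derivableP Dh; rewrite /euler derive1E => Kg.
have gh : dot (g x) (h x).1 = dot (g x) ('D_1 (fun y => (h y).2) x).
  have := dot_antisym (g x) KT; rewrite Kg /dot mulmxBr mxE [X in _ + X]mxE.
  by move=> /eqP; rewrite subr_eq0 => /eqP.
rewrite flux_formE; apply: is_derive_eq.
  exact: is_deriveN (is_derive_dot Dg Dh).
by rewrite -gh addrC.
Qed.

(** * Partial derivatives of functions of two real variables *)

Lemma is_derive_fst (R : realType) (W : normedModType R) (f : R * R -> W)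
    (y s : R) :
  differentiable f (y, s) ->
  is_derive y 1 (fun r => f (r, s)) ('D_(1, 0) f (y, s)).
Proof.
have E r : (r, s) = (0, s) + r *: (1, 0) :> R * R.
  by apply/pair_equal_spec; rewrite /= scaler0 add0r addr0 [r *: 1]mulr1.
have -> : (fun r => f (r, s)) = (fun r => f ((0, s) + r *: (1, 0))).
  by apply/funext => r; rewrite E.
move=> df; apply: is_derive_along; rewrite -E.
exact/derivableP/diff_derivable.
Qed.

Lemma is_derive_snd (R : realType) (W : normedModType R) (f : R * R -> W)
    (y s : R) :
  differentiable f (y, s) ->
  is_derive s 1 (fun r => f (y, r)) ('D_(0, 1) f (y, s)).
Proof.
have E r : (y, r) = (y, 0) + r *: (0, 1) :> R * R.
  by apply/pair_equal_spec; rewrite /= scaler0 add0r addr0 [r *: 1]mulr1.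
have -> : (fun r => f (y, r)) = (fun r => f ((y, 0) + r *: (0, 1))).
  by apply/funext => r; rewrite E.
move=> df; apply: is_derive_along; rewrite -E.
exact/derivableP/diff_derivable.
Qed.

(** * The conservation laws *)

Theorem proposition3 (R : realType) (n : nat)
    (H : phase R n -> R) (K : 'M[R]_n)
    (dg : (phase R n -> R) -> phase R n -> phase R n -> phase R n) (dt : R)
    (H_smooth : smooth H) (K_antisym : K^T = - K)
    (dg_ax : discrete_gradient dg) (dt_neq0 : dt != 0) :
  exists B : bdform R n,
    (forall (I J : set R) (z : R -> R -> 'cV[R]_n),
       open_interval I -> open_interval J ->
       smooth_on (I `*` J) (fun p : R * R => z p.1 p.2) ->
       pde_solution H K I J z ->
       forall x t, I x -> J t ->
         derive1 (fun s => H (prolong (z ^~ s) x)) t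
         + derive1 (bdf_eval B (fun y => derive1 (z y) t)
                             (grad_along H (z ^~ t))) x
         = 0)
    /\
    (forall (I : set R) (z0 z1 : R -> 'cV[R]_n),
       open_interval I -> smooth_on I z0 -> smooth_on I z1 ->
       dgm_solution (dg H) K dt I z0 z1 ->
       let flux :=
         bdf_eval B (increment dt z0 z1) (dgrad_along (dg H) z0 z1) in
       (* every x-derivative occurring in the conservation law exists *)
       times_derivable (bdf_r B).-1 I (dgrad_along (dg H) z0 z1) /\
       forall x, I x ->
         derivable flux x 1 /\
         (H (prolong z1 x) - H (prolong z0 x)) / dt + derive1 flux x = 0).
Proof.
exists (flux_form R n); split.
  move=> I J z [oI _] [oJ _] sz sol x t Ix Jt.
  pose U := I `*` J; pose Z (p : R * R) := z p.1 p.2.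
  have oU : open U.
    rewrite openE => -[y s] [Iy Js]; exists (I, J) => //.
    by split; exact: open_nbhs_nbhs.
  have nI : \forall y \near x, U (y, t).
    by apply: filterS (open_nbhs_nbhs (conj oI Ix)) => y Iy.
  have nJ : \forall s \near t, U (x, s).
    by apply: filterS (open_nbhs_nbhs (conj oJ Jt)) => s Js.
  have Uxt : U (x, t) by [].
  have dZ : forall p, U p -> differentiable Z p by exact: (sz [::]).
  have dZx : forall p, U p -> differentiable ('D_(1, 0) Z) p.
    exact: (sz [:: (1, 0)]).
  have dZt : forall p, U p -> differentiable ('D_(0, 1) Z) p.
    exact: (sz [:: (0, 1)]).
  have Zx y s : U (y, s) -> derive1 (z ^~ s) y = 'D_(1, 0) Z (y, s).
    by move=> Uys; rewrite derive1E; case: (is_derive_fst (dZ _ Uys)).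
  have Zt y s : U (y, s) -> derive1 (z y) s = 'D_(0, 1) Z (y, s).
    by move=> Uys; rewrite derive1E; case: (is_derive_snd (dZ _ Uys)).
  (* P is the prolongation of z, expressed through derivatives on the plane: it
     equals prolong only on U, but is visibly differentiable there. *)
  pose P p : phase R n := (Z p, 'D_(1, 0) Z p).
  have PE y s : U (y, s) -> P (y, s) = prolong (z ^~ s) y.
    by move=> Uys; rewrite /prolong Zx.
  have dP p : U p -> differentiable P p.
    by move=> Up; apply: differentiable_pair; [exact: dZ|exact: dZx].
  have dH v : differentiable H v := H_smooth [::] v Logic.I.
  have energy : derive1 (fun s => H (prolong (z ^~ s) x)) t
      = inner ('D_(0, 1) Z (x, t), 'D_(0, 1) ('D_(1, 0) Z) (x, t))
              (grad_along H (z ^~ t) x).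
    rewrite derive1E (near_eq_derive (g := fun s => (H \o P) (x, s))); last first.
      by apply: filterS nJ => s Us; rewrite /= PE.
    have dHP : differentiable (H \o P) (x, t).
      by apply: differentiable_comp; [exact: dP|exact: dH].
    have [_ ->] := is_derive_snd dHP.
    rewrite deriveE// diff_comp//=; last exact: dP.
    rewrite diff_pair /=; [|exact: dZ|exact: dZx].
    rewrite (diff_grad _ (dH _)) /grad_along -(PE _ _ Uxt).
    by rewrite (deriveE _ (dZ _ Uxt)) (deriveE _ (dZx _ Uxt)).
  have Dg : is_derive x 1 (fun y => derive1 (z y) t)
      ('D_(1, 0) ('D_(0, 1) Z) (x, t)).
    apply: near_eq_is_derive (is_derive_fst (dZt _ Uxt)).
    by apply: filterS nI => y Uy; rewrite Zt.
  have dh2 : derivable (fun y => (grad_along H (z ^~ t) y).2) x 1.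
    apply: (@near_eq_derivable _ _ _ (fun y => (grad H (P (y, t))).2)).
      by apply: filterS nI => y Uy; rewrite PE.
    apply/derivable_mxP => i j; under eq_fun do rewrite mxE.
    have dHiP : differentiable ('D_(0, delta_mx i 0) H \o P) (x, t).
      apply: differentiable_comp; first exact: dP.
      exact: (H_smooth [:: (0, delta_mx i 0)]).
    by case: (is_derive_fst dHiP).
  have [_ DF] := is_derive_flux K_antisym Dg dh2 (sol x t Ix Jt).
  rewrite [X in _ + X]derive1E DF energy Zt//.
  by rewrite (smooth_derive_comm _ _ oU sz Uxt) subrr.
(* The flux contains h but none of its derivatives, so that the requirement of
   differentiability of h along the solution is vacuous. *)
move=> I z0 z1 _ s0 s1 sol flux; split=> // x Ix.
have [dh2 eq] := sol x Ix.
have Dg : is_derive x 1 (increment dt z0 z1)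
    (dt^-1 *: (derive1 z1 x - derive1 z0 x)).
  rewrite !derive1E; apply: is_deriveZ; apply: is_deriveB; apply: derivableP;
    apply: diff_derivable.
    exact: (s1 [::]).
  exact: (s0 [::]).
have [dF DF] := is_derive_flux K_antisym Dg dh2 eq.
split=> //; rewrite derive1E [X in _ + X]DF.
rewrite -(dg_ax _ H_smooth) /inner /increment /=.
rewrite !linearZ /= -!scalemxAl !mxE.
by rewrite -mulrDr mulrC subrr.
Qed.
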